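(* Let $G$ be a connected finite simple bipartite graph with a perfect matching and $2n\geq 6$ vertices. Then $$0\leq gf(G)-Af(G)\leq \tfrac{1}{2}(n-1)(n-2),$$ and the right-hand equality holds if and only if $G$ is isomorphic to the complete bipartite graph $K_{n,n}$.
   Context: For a perfect matching $M$ of $G$, $af(G,M)$ is the minimum size of a subset $S\subseteq E(G)\setminus M$ such that $G-S$ (delete the edges of $S$) has a unique perfect matching, and $Af(G)=\max_M af(G,M)$ over all perfect matchings. $gf(G)$ is the minimum size of an edge subset $S$ such that no two distinct perfect matchings $M_1,M_2$ of $G$ satisfy $M_1\cap S=M_2\cap S$. *)

(* Defs.v *)
From mathcomp Require Import all_boot.

Set Implicit Arguments.
Unset Strict Implicit.
Unset Printing Implicit Defensive.

(* A finite simple graph is a symmetric irreflexive relation on a finType. *)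

Section Graph.
Variable T : finType.
Implicit Types (e : rel T) (S M : {set {set T}}).

Definition connected e : Prop := forall x y : T, connect e x y.

Definition bipartite e : Prop :=
  exists A : {set T}, forall x y : T, e x y -> (x \in A) != (y \in A).

Definition edges e : {set {set T}} :=
  [set f : {set T} | [exists x, exists y, e x y && (f == [set x; y])]].

Definition del_edges e S : rel T := [rel x y | e x y && ([set x; y] \notin S)].

Definition perfect_matching e M : bool :=
  (M \subset edges e) && [forall x : T, #|[set f in M | x \in f]| == 1].

Definition unique_perfect_matching e : bool :=
  #|[set M | perfect_matching e M]| == 1.

Definition anti_forcing e M S : bool :=
  (S \subset edges e :\: M) && unique_perfect_matching (del_edges e S).

Definition global_forcing e S : bool :=
  (S \subset edges e) &&
  [forall M1, forall M2,
    [&& perfect_matching e M1, perfect_matching e M2 & M1 != M2]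
      ==> (M1 :&: S != M2 :&: S)].

(* [arg min_] needs a feasible starting set to be a genuine minimum; see
   [anti_forcing_default] and [global_forcing_default]. *)
Definition af e M : nat :=
  #|[arg min_(S < edges e :\: M | anti_forcing e M S) #|S|]|.

Definition Af e : nat := \max_(M | perfect_matching e M) af e M.

Definition gf e : nat :=
  #|[arg min_(S < edges e | global_forcing e S) #|S|]|.

Lemma edges_del e S : edges (del_edges e S) = edges e :\: S.
Proof.
apply/setP=> f; rewrite !inE; apply/idP/idP.
  case/existsP=> x /existsP[y /andP[/= /andP[exy nS] /eqP->]].
  by rewrite nS; apply/existsP; exists x; apply/existsP; exists y; rewrite exy /=.
case/andP=> nS /existsP[x /existsP[y /andP[exy /eqP Ef]]].
apply/existsP; exists x; apply/existsP; exists y.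
by rewrite /del_edges /= exy -Ef nS eqxx.
Qed.

Lemma anti_forcing_default e M :
  perfect_matching e M -> anti_forcing e M (edges e :\: M).
Proof.
case/andP=> sM /forallP cM; rewrite /anti_forcing subxx /=.
have Ed : edges (del_edges e (edges e :\: M)) = M.
  by rewrite edges_del setDDr setDv set0U; apply/setIidPr.
apply/eqP/(@eq_card1 _ M) => N; rewrite !inE /perfect_matching Ed.
apply/idP/eqP=> [/andP[sN /forallP cN] | ->]; last first.
  by rewrite subxx; apply/forallP.
apply/eqP; rewrite eqEsubset sN; apply/subsetP=> f fM.
have: f \in edges e by apply: (subsetP sM).
rewrite inE => /existsP[x /existsP[y /andP[_ /eqP Ef]]].
have xf : x \in f by rewrite Ef !inE eqxx.
have /cards1P[g Eg] := cM x; have /cards1P[h Eh] := cN x.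
have: h \in [set f in N | x \in f] by rewrite Eh set11.
rewrite inE => /andP[hN xh].
have: f \in [set f in M | x \in f] by rewrite inE fM.
have: h \in [set f in M | x \in f] by rewrite inE (subsetP sN).
by rewrite Eg !inE => /eqP<- /eqP->.
Qed.

Lemma global_forcing_default e : global_forcing e (edges e).
Proof.
rewrite /global_forcing subxx /=.
apply/forallP=> M1; apply/forallP=> M2; apply/implyP.
case/and3P=> /andP[s1 _] /andP[s2 _].
by rewrite (setIidPl s1) (setIidPl s2).
Qed.

End Graph.

Definition isomorphic (T U : finType) (e : rel T) (d : rel U) : Prop :=
  exists2 f : T -> U, bijective f & forall x y, d (f x) (f y) = e x y.

Definition complete_bipartite (m n : nat) : rel ('I_m + 'I_n) :=
  fun u v => match u, v with
             | inl _, inr _ | inr _, inl _ => true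
             | _, _ => false
             end.
Arguments complete_bipartite : clear implicits.

(* Main.v *)
(* Contract a perfect matching M of G: with the i-th edge of M joining a_i to
   b_i, G is the reflexive digraph D = {(i,j) | a_i b_j is an edge} on n points,
   the perfect matchings are the permutations s with (i, s i) in D, and an
   anti-forcing set of M meets every non-identity permutation of that kind.

   gf >= Af.  The complement F of a global forcing set contains no symmetric
   difference of two perfect matchings, and then some row has at most one edge
   in F.  Deleting that row and its partner, and putting the other edges of the
   row in the anti-forcing set, gives the inequality by induction.

   Upper bound.  The complement of a spanning tree is a global forcing set, so
   gf <= m - 2n + 1.  If K is anti-forcing for M, then D \ K is antisymmetric,
   so m - |K| <= n + n(n-1)/2.

   Equality.  Then D \ K is a linear order for every M, and G has no cycle C
   such that G - V(C) has no perfect matching, for otherwise the spanning tree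
   could be replaced by a connected spanning subgraph containing C and one more
   edge.  If a_j b_i is not an edge, these orders provide a Hamiltonian cycle of
   G - a_j - b_i, which is such a cycle; hence G is complete. *)
Require Import Defs.
From mathcomp Require Import all_boot all_order all_algebra all_fingroup.
From mathcomp Require Import zify lra.

Set Implicit Arguments.
Unset Strict Implicit.
Unset Printing Implicit Defensive.

(** * Matchings of reflexive digraphs, discerning sets and anti-forcing sets *)

Section Core.
Variable I : finType.
Implicit Types (D F K S L : {set I * I}) (X : {set I}) (s t : {perm I}).

(** A perfect matching of the subdigraph on [X], extended by the identity: deleting a point shrinks
    [X] while the type of permutations stays the same. *)
Definition dmatching D X s := perm_on X s && [forall i in X, (i, s i) \in D].

(** The property of the complement of a global forcing set: [F] contains the symmetric difference of
    no two distinct matchings, read row by row. *)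
Definition discerning D X F := forall s t,
  dmatching D X s -> dmatching D X t ->
  (forall i, s i != t i -> ((i, s i) \in F) && ((i, t i) \in F)) -> s = t.

(** A minimal nonempty [h]-stable subset of [X] works, since its image is again nonempty and
    stable. *)
Lemma cycle_subset (h : I -> I) X : X != set0 -> {in X, forall i, h i \in X} ->
  exists2 Z : {set I}, (Z != set0) && (Z \subset X) & h @: Z = Z.
Proof.
move=> X0 hX.
have PX : [&& X != set0, X \subset X & h @: X \subset X].
  by rewrite X0 subxx; apply/subsetP=> _ /imsetP[i iX ->]; exact: hX.
case: (@arg_minnP _ X (fun Z => [&& Z != set0, Z \subset X & h @: Z \subset Z])
         (fun Z => #|Z|) PX) => Z /and3P[Z0 ZX hZ] Zmin.
exists Z; first by rewrite Z0.
apply/eqP; rewrite eqEcard hZ; apply: Zmin; apply/and3P; split.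
- by case/set0Pn: Z0 => z zZ; apply/set0Pn; exists (h z); apply: imset_f.
- exact: subset_trans hZ ZX.
- exact: imsetS.
Qed.

Lemma dmatching1 D X : {in X, forall i, (i, i) \in D} -> dmatching D X 1.
Proof.
move=> Dr; rewrite /dmatching perm_on1; apply/forall_inP=> i iX.
by rewrite perm1 Dr.
Qed.

(* A perfect matching sharing as many edges with [F] as possible cannot be
   switched along a cycle that enters every row through [F]. *)
Lemma sparse_row D X F : {in X, forall i, (i, i) \in D} -> F \subset D ->
  X != set0 -> discerning D X F ->
  exists2 a, a \in X & #|[set y in X | (a, y) \in F]| <= 1.
Proof.
move=> Dr FD X0 dF.
have [/exists_inP[a aX aF]|] :=
  boolP [exists a in X, #|[set y in X | (a, y) \in F]| <= 1]; first by exists a.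
rewrite negb_exists_in => /forall_inP big.
case: (arg_maxnP (fun s => #|[set i in X | (i, s i) \in F]|) (dmatching1 Dr))
  => s /andP[sX /forall_inP sD] smax.
(* Row [a] has two entries of [F] inside [X], so one of them avoids [s a]; the default is never
   taken on [X]. *)
pose g a := odflt a [pick y in X | ((a, y) \in F) && (y != s a)].
have gP a : a \in X -> [&& g a \in X, (a, g a) \in F & g a != s a].
  move=> aX; rewrite /g; case: pickP => //= none.
  have := big a aX; rewrite -ltnNge => /card_gt1P[y [z [yX zX yz]]].
  move: yX zX; rewrite !inE => /andP[yX yF] /andP[zX zF].
  have := none y; have := none z; rewrite yX yF zX zF /= => /eqP zs /eqP ys.
  by rewrite zs ys eqxx in yz.
(* [h a] is the row that [s] matches to the column [g a]. On a set [Z] permuted by [h], every row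
   can take over the column [g] without conflict. *)
pose h a := (s^-1)%g (g a).
have sh a : s (h a) = g a by rewrite permKV.
have hX : {in X, forall i, h i \in X}.
  move=> a aX; have /and3P[gX _ _] := gP a aX.
  by rewrite -(perm_closed _ sX) sh.
have [Z /andP[Z0 ZX] hZ] := cycle_subset X0 hX.
have hinj : {in Z &, injective h} by apply/imset_injP; rewrite hZ.
pose h' i := if i \in Z then h i else i.
have h'Z i : (h' i \in Z) = (i \in Z).
  by rewrite /h'; case: ifP => // iZ; rewrite -hZ imset_f.
have h'inj : injective h'.
  move=> i j eq; have := congr1 (fun x => x \in Z) eq; rewrite /= !h'Z.
  move: eq; rewrite /h'; case: ifP => [iZ|iZ] eq jZ; rewrite -?jZ // in eq *.
  by apply: hinj => //; rewrite -jZ.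
pose t := (perm h'inj * s)%g.
have tE i : t i = if i \in Z then g i else s i.
  by rewrite /t permM permE /h'; case: ifP => // _; rewrite sh.
have tdm : dmatching D X t.
  apply/andP; split.
    apply: perm_onM => //; apply/subsetP=> i; rewrite inE permE /h'.
    by case: ifP => [/(subsetP ZX)//|]; rewrite eqxx.
  apply/forall_inP=> i iX; rewrite tE; case: ifP => _; last exact: sD.
  by have /and3P[_ iF _] := gP i iX; apply: (subsetP FD).
have sub : [set i in X | (i, s i) \in F] \subset [set i in X | (i, t i) \in F].
  apply/subsetP=> i; rewrite !inE => /andP[iX iF]; rewrite iX tE.
  by case: ifP => // _; have /and3P[] := gP i iX.
(* Passing from [s] to [t] loses no entry of [F], so maximality makes the two sets equal. Hence on
   [Z] the entries of [s] lie in [F] as well, which is what [dF] asks for. *)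
have /eqP eqF : [set i in X | (i, s i) \in F] == [set i in X | (i, t i) \in F].
  by rewrite eqEcard sub; apply: smax.
have st : s = t.
  apply: dF => // [|i]; first by rewrite /dmatching sX; apply/forall_inP.
  rewrite tE; case: ifP => [iZ _|]; last by rewrite eqxx.
  have iX := subsetP ZX _ iZ; have /and3P[_ iF _] := gP i iX.
  have : i \in [set i in X | (i, t i) \in F] by rewrite inE iX tE iZ.
  by rewrite -eqF inE iF => /andP[_ ->].
case/set0Pn: Z0 => z zZ; have /and3P[_ _] := gP z (subsetP ZX _ zZ).
by have := tE z; rewrite zZ -st => ->; rewrite eqxx.
Qed.

Lemma dmatchingS D X X' s : X' \subset X -> {in X, forall i, (i, i) \in D} ->
  dmatching D X' s -> dmatching D X s.
Proof.
move=> XX Dr /andP[sX /forall_inP sD]; apply/andP; split.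
  exact: subset_trans sX XX.
apply/forall_inP=> i iX; have [/sD//|iX'] := boolP (i \in X').
by rewrite (out_perm sX iX') Dr.
Qed.

Lemma discerningS D X X' F : X' \subset X -> {in X, forall i, (i, i) \in D} ->
  discerning D X F -> discerning D X' F.
Proof. by move=> XX Dr dF s t /(dmatchingS XX Dr) ds /(dmatchingS XX Dr) dt; exact: dF. Qed.

(** Induction on [X], deleting a sparse row [a] together with its partner column. Bounding by [S]
    inside [X] times [X] lets the costs of successive rows add up. *)
Lemma anti_forcing_of_discerning D X S :
  {in X, forall i, (i, i) \in D} -> discerning D X (D :\: S) ->
  exists K : {set I * I},
   [/\ K \subset D, forall i, (i, i) \notin K, #|K| <= #|S :&: setX X X| &
       forall t, dmatching D X t -> {in X, forall i, (i, t i) \notin K} ->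
         t = 1%g].
Proof.
have [k] := ubnP #|X|; elim: k X => // k IH X Xk Dr dF.
have [X0|X0] := eqVneq X set0.
  exists set0; split; rewrite ?sub0set ?cards0 //; first by move=> i; rewrite inE.
  move=> t /andP[tX _] _; apply/permP=> i; rewrite perm1 (out_perm tX) //.
  by rewrite X0 inE.
have [a aX aF] := sparse_row Dr (subsetDl D S) X0 dF.
have Dr' : {in X :\ a, forall i, (i, i) \in D}.
  by move=> i /setD1P[_ /Dr].
have [||K [KD Kd Kc Kf]] := IH (X :\ a) _ Dr'.
- by move: Xk; rewrite (cardsD1 a) aX; lia.
- exact: discerningS (subsetDl _ _) Dr dF.
pose R := [set (a, y) | y in [set y in X :\ a | (a, y) \in D]].
have inR i y : ((i, y) \in R) = [&& i == a, y != a, y \in X & (a, y) \in D].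
  apply/imsetP/and4P=> [[z]|[/eqP-> ya yX yD]].
    by rewrite !inE => /andP[/andP[za zX] zD] [-> ->]; split.
  by exists y; rewrite ?inE ?ya ?yX.
exists (K :|: R); split.
- rewrite subUset KD /=; apply/subsetP=> -[i y].
  by rewrite inR => /and4P[/eqP-> _ _].
- move=> i; rewrite in_setU negb_or Kd inR /=.
  by case: eqP => // ->; rewrite eqxx.
(* At most one entry of row [a] lies outside [S], and the loop at [a], which [R] omits, pays for
   it. *)
- have cR : #|R| <= #|S :&: setX [set a] X|.
    have inj : injective (fun y : I => (a, y)) by move=> y z [].
    rewrite card_imset //.
    have -> : S :&: setX [set a] X = [set (a, y) | y in [set y in X | (a, y) \in S]].
      apply/setP=> -[i y]; apply/idP/imsetP=> [|[z]].
        by rewrite !inE => /and3P[iS /eqP ia yX]; exists y; rewrite ?inE -ia ?yX.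
      by rewrite !inE => /andP[zX zS] [-> ->]; rewrite zS zX eqxx.
    rewrite card_imset //.
    have : #|[set y in X | (a, y) \in D]| <=
           #|[set y in X | (a, y) \in D :\: S]| + #|[set y in X | (a, y) \in S]|.
      apply: leq_trans (leq_card_setU _ _); apply/subset_leq_card/subsetP=> y.
      by rewrite !inE => /andP[-> ->]; rewrite /= andbT orNb.
    rewrite (cardsD1 a [set y in X | _ \in D]) inE aX Dr //.
    have -> : [set y in X | (a, y) \in D] :\ a = [set y in X :\ a | (a, y) \in D].
      by apply/setP=> y; rewrite !inE andbA.
    by lia.
  have dis : [disjoint S :&: setX [set a] X & S :&: setX (X :\ a) (X :\ a)].
    rewrite -setI_eq0; apply/eqP/setP=> -[i y]; rewrite !inE /=.
    by case: eqP => //=; rewrite ?andbF.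
  have sub : S :&: setX [set a] X :|: S :&: setX (X :\ a) (X :\ a)
              \subset S :&: setX X X.
    rewrite -setIUr; apply: setIS; apply/subsetP=> -[i y]; rewrite !inE /=.
    by case/orP=> [/andP[/eqP-> ->]|/andP[/andP[_ ->] /andP[_ ->]]]; rewrite ?aX.
  have := subset_leq_card sub; rewrite cardsU (disjoint_setI0 dis) cards0 subn0.
  by move=> le; apply: leq_trans (leq_card_setU K R) (leq_trans _ le); rewrite addnC leq_add.
- move=> t /andP[tX /forall_inP tD] tK.
  (* Avoiding [R] leaves only the loop in row [a], so [t] restricts to a matching on [X :\ a]. *)
  have ta : t a = a.
    have := tK a aX; rewrite in_setU negb_or inR eqxx tD //= andbT.
    by rewrite (perm_closed _ tX) aX andbT negbK => /andP[_ /eqP].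
  apply: Kf => [|i /setD1P[ia iX]]; last first.
    by have := tK i iX; rewrite in_setU negb_or => /andP[].
  apply/andP; split.
    apply/subsetP=> i; rewrite inE => ti; rewrite !inE (subsetP tX) ?inE // andbT.
    by apply: contraNneq ti => ->; rewrite ta.
  by apply/forall_inP=> i /setD1P[_ /tD].
Qed.

(** * Reflexive digraphs whose only matching is the identity *)

Section Tournament.
Variable L : {set I * I}.
Hypothesis Lrefl : forall i, (i, i) \in L.
Hypothesis Luniq : forall t, (forall i, (i, t i) \in L) -> t = 1%g.

Lemma unique_anti i j : (i, j) \in L -> (j, i) \in L -> i = j.
Proof.
move=> ij ji; have [//|nij] := eqVneq i j.
have : tperm i j = 1%g.
  by apply: Luniq => k; case: tpermP => [->|->|].
by move/permP/(_ i); rewrite tpermL perm1 => ->.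
Qed.

Let LT := [set (p.2, p.1) | p in L].

Let mem_LT i j : ((i, j) \in LT) = ((j, i) \in L).
Proof.
apply/imsetP/idP=> [[[k l] kl [-> ->]] //|ji].
by exists (j, i).
Qed.

Let card_LT : #|LT| = #|L|.
Proof. by apply: card_imset => -[i j] [k l] [-> ->]. Qed.

Let card_LILT : #|L :&: LT| <= #|I|.
Proof.
rewrite -(@card_imset _ _ (fun i : I => (i, i))); last by move=> i j [].
apply/subset_leq_card/subsetP=> -[i j]; rewrite inE mem_LT => /andP[ij ji].
by rewrite (unique_anti ij ji) imset_f.
Qed.

(** [L] and its transpose meet only on the diagonal, and their union has at most [#|I| * #|I|]
    elements. *)
Lemma unique_card : 2 * #|L| <= #|I| * #|I|.+1.
Proof.
have := cardsUI L LT; rewrite card_LT => eq.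
have : #|L :|: LT| <= #|I| * #|I| by rewrite -card_prod max_card.
by move: card_LILT; nia.
Qed.

Hypothesis Lmax : 2 * #|L| = #|I| * #|I|.+1.

Lemma unique_max_total i j : ((i, j) \in L) || ((j, i) \in L).
Proof.
have UT : L :|: LT = setT.
  apply/eqP; rewrite eqEcard subsetT cardsT card_prod.
  have := cardsUI L LT; rewrite card_LT.
  by move: card_LILT Lmax; nia.
by have := in_setT (i, j); rewrite -UT in_setU mem_LT.
Qed.

(** If transitivity failed, totality would give [(k, i)], and the 3-cycle sending [i] to [j], [j] to
    [k] and [k] to [i] would be a second matching. *)
Lemma unique_max_trans i j k : (i, j) \in L -> (j, k) \in L -> (i, k) \in L.
Proof.
move=> ij jk; have [//|nik] := boolP ((i, k) \in L).
have ki : (k, i) \in L by have := unique_max_total i k; rewrite (negbTE nik).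
have nij : i != j by apply: contraNneq nik => ->.
have nkj : k != j by apply: contraNneq nik => ->.
have ik : i != k by apply: contraNneq nik => <-; apply: Lrefl.
have : (tperm i j * tperm i k)%g = 1%g.
  apply: Luniq => x; rewrite permM.
  case: (tpermP i j x) => [->|->|xi xj]; first by rewrite tpermD.
    by rewrite tpermL.
  by case: tpermP => // ->.
move/permP/(_ i); rewrite permM tpermL perm1 tpermD // => ji.
by rewrite -ji eqxx in nij.
Qed.

End Tournament.
End Core.

(** * Discerning sets of the complete digraph *)

Section CompleteDigraph.
Variable I : finType.
Implicit Types (F : {set I * I}) (X : {set I}) (s t : {perm I}).

Lemma dmatchingT X s : dmatching setT X s = perm_on X s.
Proof. by rewrite /dmatching; case: perm_on => //=; apply/forall_inP=> i; rewrite inE. Qed.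

(** Transposing the digraph inverts its matchings, so facts about rows transfer to columns. *)
Lemma discerning_swap X F :
  discerning setT X F -> discerning setT X [set p | (p.2, p.1) \in F].
Proof.
move=> dF s t; rewrite !dmatchingT => sX tX st.
apply: invg_inj; apply: dF; rewrite ?dmatchingT ?perm_onV // => j nj.
have tj : t ((s^-1)%g j) != j by rewrite -(inj_eq (@perm_inj _ t^-1)) permK.
have sj : s ((t^-1)%g j) != j by rewrite -(inj_eq (@perm_inj _ s^-1)) permK eq_sym.
have := st ((s^-1)%g j); have := st ((t^-1)%g j).
rewrite !permKV !inE /= => /(_ sj)/andP[_ ->].
by rewrite eq_sym => /(_ tj)/andP[-> _].
Qed.

Lemma discerning_relabel X F s0 : perm_on X s0 ->
  discerning setT X F -> discerning setT X [set p | (p.1, s0 p.2) \in F].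
Proof.
move=> s0X dF s t; rewrite !dmatchingT => sX tX st.
apply: (mulIg s0); apply: dF; rewrite ?dmatchingT ?perm_onM // => i.
by rewrite !permM (inj_eq perm_inj) => /st; rewrite !inE.
Qed.

(** There is a sparse row and, by transposition, a sparse column. Removing both costs at most two
    entries of [F], and a single point carries at most one. *)
Lemma discerning_complete_card X F : X != set0 -> F \subset setX X X ->
  discerning setT X F -> #|F| < 2 * #|X|.
Proof.
have [k] := ubnP #|X|; elim: k X F => // k IH X F Xk X0 FX dF.
have refl : {in X, forall i, (i, i) \in [set: I * I]} by move=> i _; rewrite inE.
have [a aX aF] := sparse_row refl (subsetT F) X0 dF.
have [b bX bF] := sparse_row refl (subsetT _) X0 (discerning_swap dF).
(* Every row may be partnered with every column here, so the columns are renumbered to give the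
   sparse column [b] the index [a] of the sparse row. *)
pose F1 := [set p | (p.1, tperm a b p.2) \in F].
have tX : perm_on X (tperm a b).
  by apply/subsetP=> i; rewrite inE; case: tpermP => [->|->|]; rewrite ?eqxx.
have dF1 : discerning setT X F1 by apply: discerning_relabel.
have cF1 : #|F1| = #|F|.
  have inj : injective (fun p : I * I => (p.1, tperm a b p.2)).
    by move=> [i j] [k' l] /= [-> /perm_inj->].
  rewrite -[RHS](card_preimset _ inj).
  by apply: eq_card => p; rewrite !inE.
have F1X : F1 \subset setX X X.
  apply/subsetP=> -[i j]; rewrite !inE /= => /(subsetP FX).
  by rewrite inE /= (perm_closed _ tX).
have rowa : #|[set y in X | (a, y) \in F1]| <= 1.
  apply: leq_trans aF; rewrite -[leqRHS](card_preimset _ (@perm_inj _ (tperm a b))).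
  by apply/subset_leq_card/subsetP=> y; rewrite !inE /= (perm_closed _ tX).
have cola : #|[set x in X | (x, a) \in F1]| <= 1.
  apply: leq_trans bF.
  by apply/subset_leq_card/subsetP=> x; rewrite !inE /= tpermL.
have Xa := cardsD1 a X; rewrite aX add1n in Xa.
rewrite -cF1; have [Xa0|Xa0] := eqVneq (X :\ a) set0.
  have := subset_leq_card F1X; rewrite cardsX Xa Xa0 cards0; lia.
pose F2 := F1 :&: setX (X :\ a) (X :\ a).
have cF2 : #|F2| < 2 * #|X :\ a|.
  apply: IH => //; [by move: Xk; rewrite Xa | exact: subsetIr |].
  move=> s t; rewrite !dmatchingT => sX tX' st.
  have XaX : X :\ a \subset X by apply: subsetDl.
  apply: dF1; rewrite ?dmatchingT; [exact: subset_trans sX XaX | exact: subset_trans tX' XaX|].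
  by move=> i /st; rewrite !inE => /andP[/andP[-> _] /andP[-> _]].
have sub : F1 \subset F2 :|: ([set (a, y) | y in [set y in X | (a, y) \in F1]]
             :|: [set (x, a) | x in [set x in X | (x, a) \in F1]]).
  apply/subsetP=> -[i j] ijF; have := subsetP F1X _ ijF.
  rewrite in_setX /= => /andP[iX jX]; rewrite !in_setU.
  have [Ei|ia] := eqVneq i a.
    by apply/orP; right; apply/orP; left; apply/imsetP; exists j; [rewrite inE jX -Ei | rewrite Ei].
  have [Ej|ja] := eqVneq j a.
    by apply/orP; right; apply/orP; right; apply/imsetP; exists i; [rewrite inE iX -Ej | rewrite Ej].
  by rewrite inE ijF in_setX !in_setD1 ia ja iX jX.
apply: leq_ltn_trans (subset_leq_card sub) _.
apply: leq_ltn_trans (leq_card_setU _ _) _.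
apply: (@leq_ltn_trans (#|F2| + (1 + 1))); last by rewrite Xa; move: cF2; lia.
rewrite leq_add2l; apply: leq_trans (leq_card_setU _ _) _.
by apply: leq_add; apply: leq_trans (leq_imset_card _ _) _.
Qed.
End CompleteDigraph.

(** A least moved point would be sent to a smaller, fixed point, against injectivity. *)
Lemma perm_le_id n (s : {perm 'I_n}) : (forall i, s i <= i) -> s = 1%g.
Proof.
move=> le; apply/permP=> i; rewrite perm1.
have [k] := ubnP (i : nat); elim: k i => // k IH i ik.
have [//|ne] := eqVneq (s i) i.
have lt : s i < i by rewrite ltn_neqAle le andbT.
by apply: (@perm_inj _ s); apply: IH; apply: leq_trans lt _.
Qed.

(** * Complements of global forcing sets in a graph *)

Section Graph.
Variables (T : finType) (e : rel T).
Implicit Types (F M W : {set {set T}}).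

(** For sets of edges, this says exactly that the complement is global forcing, so computing [gf]
    amounts to finding the largest such [F]. *)
Definition nonconformal F := forall M1 M2,
  perfect_matching e M1 -> perfect_matching e M2 ->
  (M1 :\: M2) :|: (M2 :\: M1) \subset F -> M1 = M2.

Lemma global_forcing_compl F : F \subset edges e -> nonconformal F ->
  global_forcing e (edges e :\: F).
Proof.
move=> Fe nF; rewrite /global_forcing subsetDl /=.
apply/forallP=> M1; apply/forallP=> M2; apply/implyP=> /and3P[p1 p2].
apply: contraNneq => eqM; apply/eqP; apply: nF => //.
have [/andP[s1 _] /andP[s2 _]] := (p1, p2).
apply/subsetP=> f fD; apply: contraLR (fD) => fF.
have := congr1 (fun A : {set {set T}} => f \in A) eqM.
rewrite /= in_setU !in_setI !in_setD fF /=.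
have := subsetP s1 f; have := subsetP s2 f.
by case: (f \in M1); case: (f \in M2) => //= h2 h1; [rewrite h1 | rewrite h2].
Qed.

Lemma gf_leP F : F \subset edges e -> nonconformal F ->
  gf e + #|F| <= #|edges e|.
Proof.
move=> Fe nF; rewrite /gf.
case: arg_minnP => [|S _ /(_ _ (global_forcing_compl Fe nF))].
  exact: global_forcing_default.
by have := cardsD (edges e) F; rewrite (setIidPr Fe); have := subset_leq_card Fe; lia.
Qed.

Lemma gf_attained : exists F,
  [/\ F \subset edges e, nonconformal F & gf e + #|F| = #|edges e|].
Proof.
rewrite /gf; case: arg_minnP => [|S /andP[Se /forallP gS] _].
  exact: global_forcing_default.
exists (edges e :\: S); split; first exact: subsetDl.
  move=> M1 M2 p1 p2 sub; apply/eqP; apply: contraT => ne.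
  have := forallP (gS M1) M2; rewrite p1 p2 ne /=.
  have nS f : f \in (M1 :\: M2) :|: (M2 :\: M1) -> f \notin S.
    by move/(subsetP sub); rewrite inE => /andP[].
  case/eqP; apply/setP=> f; have := nS f; rewrite !inE.
  by case: (f \in M1); case: (f \in M2) => //= /(_ isT)/negbTE->.
by have := cardsD (edges e) S; rewrite (setIidPr Se); have := subset_leq_card Se; lia.
Qed.

Lemma perfect_matching_uniq M x f g : perfect_matching e M ->
  f \in M -> g \in M -> x \in f -> x \in g -> f = g.
Proof.
case/andP=> _ /forallP/(_ x)/cards1P[h E] fM gM xf xg.
have : f \in [set h in M | x \in h] by rewrite inE fM.
have : g \in [set h in M | x \in h] by rewrite inE gM.
by rewrite E !inE => /eqP-> /eqP->.
Qed.

Lemma perfect_matching_cover M x : perfect_matching e M ->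
  exists2 f, f \in M & x \in f.
Proof.
case/andP=> _ /forallP/(_ x)/cards1P[h E].
have : h \in [set f in M | x \in f] by rewrite E set11.
by rewrite inE => /andP[hM xh]; exists h.
Qed.

(** In a symmetric difference of perfect matchings, each vertex has degree 0 or 2. The new edge is
    the only one of the enlarged set at [v], so it cannot occur there. *)
Lemma nonconformal_pendant F w v : w != v -> nonconformal F ->
  {in F, forall f : {set T}, v \notin f} -> nonconformal ([set w; v] |: F).
Proof.
move=> wv nF vF M1 M2 p1 p2 sub; apply: nF => //.
apply/subsetP=> f fD; have := subsetP sub f fD.
rewrite in_setU1 => /predU1P[Ef|//]; exfalso.
have [f1 f1M v1] := perfect_matching_cover v p1.
have [f2 f2M v2] := perfect_matching_cover v p2.
have only g : g \in (M1 :\: M2) :|: (M2 :\: M1) -> v \in g -> g = [set w; v].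
  by move/(subsetP sub); rewrite in_setU1 => /predU1P[//|/vF/negbTE->].
have f12 : f1 = f2.
  have [f1M2|f1M2] := boolP (f1 \in M2); first exact: perfect_matching_uniq p2 _ _ v1 v2.
  have [f2M1|f2M1] := boolP (f2 \in M1); first exact: perfect_matching_uniq p1 _ _ v1 v2.
  apply: etrans (only f1 _ v1) (esym (only f2 _ v2)).
    by rewrite !inE f1M2 f1M.
  by rewrite !inE f2M1 f2M orbT.
have vf : v \in f by rewrite Ef !inE eqxx orbT.
move: fD; rewrite !inE => /orP[/andP[fM2 fM1]|/andP[fM1 fM2]].
  by rewrite (perfect_matching_uniq p1 fM1 f1M vf v1) f12 f2M in fM2.
by rewrite (perfect_matching_uniq p2 fM2 f2M vf v2) -f12 f1M in fM1.
Qed.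

(** [W] absorbs the vertices one at a time along edges leaving it, each contributing one pendant
    edge. A single vertex grows into a spanning tree; a cycle grows into a unicyclic spanning
    subgraph on top of whatever [W] already holds. *)
Lemma nonconformal_extend (W : {set T}) F : connected e ->
  W != set0 -> F \subset edges e -> {in F, forall f : {set T}, f \subset W} ->
  nonconformal F ->
  exists F', [/\ F' \subset edges e, nonconformal F' & #|F'| + #|W| = #|F| + #|T|].
Proof.
move=> conn; have [k] := ubnP (#|T| - #|W|).
elim: k W F => // k IH W F Wk W0 Fe FW nF.
have [->|WT] := eqVneq W setT; first by exists F; rewrite cardsT.
have [w [v [wW vW ewv]]] : exists w v, [/\ w \in W, v \notin W & e w v].
  case/set0Pn: W0 => w0 w0W.
  have /set0Pn[v0] : ~: W != set0 by rewrite -setCT (inj_eq (@setC_inj _)).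
  rewrite inE => v0W; case/connectP: (conn w0 v0) => p.
  elim: p w0 w0W => /= [|y p IHp] w0 w0W.
    by move=> _ E; rewrite E w0W in v0W.
  case/andP=> ey yp E; have [yW|yW] := boolP (y \in W); first exact: IHp E.
  by exists w0, y.
have nvF : {in F, forall f : {set T}, v \notin f}.
  by move=> f /FW fW; apply: contra vW; apply: (subsetP fW).
have nwv : w != v by apply: contraNneq vW => <-.
have wvF : [set w; v] \notin F.
  by apply/negP=> /nvF; rewrite !inE eqxx orbT.
have [|||||F' [F'e nF' cF']] := IH (v |: W) ([set w; v] |: F).
- by have := subset_leq_card (subsetT (v |: W)); rewrite cardsT cardsU1 vW; lia.
- by apply/set0Pn; exists v; rewrite setU11.
- rewrite subUset Fe andbT sub1set inE; apply/existsP; exists w.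
  by apply/existsP; exists v; rewrite ewv eqxx.
- move=> f; rewrite in_setU1 => /predU1P[->|/FW fW].
    by rewrite subUset !sub1set !inE wW eqxx orbT.
  by apply: subset_trans fW (subsetUr _ _).
- exact: nonconformal_pendant.
by exists F'; split => //; move: cF'; rewrite !cardsU1 vW wvF; lia.
Qed.

End Graph.

(** Induction once around the cyclic list, rotated so that it starts at [x]. *)
Lemma next_closed (T : eqType) (P : T -> Prop) (w : seq T) (x : T) : uniq w ->
  x \in w -> P x -> {in w, forall y, P y -> P (next w y)} -> {in w, forall y, P y}.
Proof.
move=> uw xw Px nP.
have go p u : path (frel (next w)) u p -> {subset u :: p <= w} -> P u ->
    {in u :: p, forall y, P y}.
  elim: p u => /= [|v p IHp] u; first by move=> _ _ Pu y; rewrite inE => /eqP->.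
  case/andP=> /eqP<- up sub Pu y; rewrite inE => /predU1P[->//|].
  have uw' : u \in w by apply: sub; rewrite inE eqxx.
  apply: IHp => //; last exact: nP.
  by move=> z zp; apply: sub; rewrite inE zp orbT.
have [k q Eq] := rot_to xw.
have /= := cycle_next uw; rewrite -(rot_cycle k) Eq /= => xq y yw.
apply: (go (rcons q x) x xq) => //.
  by move=> z; rewrite inE mem_rcons inE orbA orbb -[_ || _]in_cons -Eq mem_rot.
by rewrite inE mem_rcons inE orbA orbb -[_ || _]in_cons -Eq mem_rot.
Qed.

Lemma mem_remove (T : eqType) (x : T) (u v : seq T) : uniq (u ++ x :: v) ->
  (forall y, y \in u ++ x :: v) -> u ++ v =i predC1 x.
Proof.
rewrite cat_uniq /= negb_or => /and3P[_ /andP[xu _] /andP[xv _]] all_in y.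
have := all_in y; rewrite !inE !mem_cat inE.
by case: eqP => [-> _|_ /= ->//]; rewrite (negbTE xu) (negbTE xv).
Qed.

(** * Cycles that miss one row and one column *)

Section HamiltonCycle.
Variable I : finType.
Variables (D : {set I * I}) (j : I) (c : {perm I}) (w : seq I).
Hypotheses (uw : uniq w) (wE : w =i predC1 j).

(* The cycle visiting the rows of [w] in cyclic order, where the row [r] is
   entered from the column [c r]; it misses exactly the row [j] and the
   column [c j]. *)
Definition row_cycle : {set I * I} :=
  [set p | (p.1 != j) && ((p.2 == c p.1) || (p.2 == c (next w p.1)))].

Let nextP r : r != j -> next w r != j.
Proof. by move=> rj; rewrite -[_ != j]/(_ \in predC1 j) -wE mem_next wE. Qed.

Lemma row_cycle_miss p : p \in row_cycle -> (p.1 != j) && (p.2 != c j).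
Proof.
rewrite inE => /andP[rj /orP[]/eqP->]; rewrite rj (inj_eq perm_inj) //.
exact: nextP.
Qed.

Lemma row_cycle_card : 1 < size w -> #|row_cycle| = 2 * #|I|.-1.
Proof.
move=> sw.
have cI : #|[set~ j]| = #|I|.-1 by rewrite cardsC1.
have -> : row_cycle = [set (r, c r) | r in [set~ j]] :|:
                      [set (r, c (next w r)) | r in [set~ j]].
  apply/setP=> -[r y]; rewrite !inE /=; apply/andP/orP=> [[rj /orP[]/eqP->]|[]].
  - by left; apply/imsetP; exists r; rewrite ?inE.
  - by right; apply/imsetP; exists r; rewrite ?inE.
  - by case/imsetP=> r'; rewrite !inE => rj [-> ->]; rewrite eqxx.
  - by case/imsetP=> r'; rewrite !inE => rj [-> ->]; rewrite eqxx orbT.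
(* The two families of entries would share an element only if some row were its own successor, which
   needs a list of length one. *)
rewrite cardsU disjoint_setI0; last first.
  rewrite -setI_eq0; apply/eqP/setP=> -[r y]; rewrite !inE; apply/negP.
  case/andP=> /imsetP[r1 _ [-> ->]] /imsetP[r2]; rewrite !inE => r2j [-> /perm_inj E].
  have r2w : r2 \in w by rewrite wE.
  have [k q Eq] := rot_to r2w.
  have uq : uniq (r2 :: q) by rewrite -Eq rot_uniq.
  have := next_rot k uw r2; rewrite Eq -E.
  have : size (r2 :: q) = size w by rewrite -Eq size_rot.
  move: uq; case: q {Eq} => /= [_ E1|z q /andP[]]; first by rewrite -E1 in sw.
  by rewrite inE eqxx => /norP[rz _] _ _ Ez; rewrite Ez eqxx in rz.
rewrite cards0 subn0 !card_imset ?cI; first by rewrite mul2n addnn.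
  by move=> r r' [].
by move=> r r' [].
Qed.

Hypothesis jD : (j, c j) \notin D.

(** Both matchings send [j] to the same column, and that column belongs to the cycle because
    [(j, c j)] is not an entry of [D]. This yields one row where they agree, and agreement then
    spreads around the cycle. *)
Lemma row_cycle_discerning : discerning D setT row_cycle.
Proof.
move=> s t /andP[_ /forall_inP sD] /andP[_ /forall_inP tD] st.
have two r : s r != t r ->
    [/\ r != j, s r = c r \/ t r = c r & s r = c (next w r) \/ t r = c (next w r)].
  move=> nst; have := st r nst; rewrite !inE /= => /andP[/andP[rj Es] /andP[_ Et]].
  split=> //; case/orP: Es => /eqP Es; case/orP: Et => /eqP Et; rewrite ?Es ?Et; auto.
    by rewrite Es Et eqxx in nst.
  by rewrite Es Et eqxx in nst.
have stj : s j = t j.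
  by apply/eqP; apply: contraT => /two[]; rewrite eqxx.
(* The column [c r0] is taken by row [j] in both matchings, so row [r0] has only one column of the
   cycle left. *)
pose r0 := (c^-1)%g (s j); have cr0 : c r0 = s j by rewrite permKV.
have r0j : r0 != j.
  by apply: contraNneq jD => E; rewrite -{2}E cr0 sD ?inE.
have st0 : s r0 = t r0.
  apply/eqP; apply: contraT => /two[_ [] E _].
    by rewrite cr0 in E; rewrite (perm_inj E) eqxx in r0j.
  by rewrite cr0 stj in E; rewrite (perm_inj E) eqxx in r0j.
(* If [s'] takes [c (next w r)] at the row [next w r], then [t'] takes that column at another row
   where the two differ. The cycle allows only [r], where they agree. *)
have half (s' t' : {perm I}) r : r \in w ->
    (forall i, s' i != t' i -> t' i = c i \/ t' i = c (next w i)) ->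
    s' r = t' r -> s' (next w r) != t' (next w r) ->
    s' (next w r) <> c (next w r).
  move=> rw two' Er nE Ec.
  pose q := (t'^-1)%g (c (next w r)); have tq : t' q = c (next w r) by rewrite permKV.
  have qr : q != next w r by apply: contraNneq nE => E; rewrite -{2}E tq Ec.
  have : s' q != t' q.
    by apply: contraNneq qr => E; apply/eqP/(@perm_inj _ s'); rewrite E tq Ec.
  move=> /[dup] nq /two'[] E; rewrite tq in E; have E' := perm_inj E.
    by rewrite E' eqxx in qr.
  by move: nq; rewrite -(can_inj (prev_next uw) E') Er eqxx.
have in2 (s' : {perm I}) i : (i, s' i) \in row_cycle ->
    s' i = c i \/ s' i = c (next w i).
  by rewrite inE => /andP[_ /orP[]/eqP]; auto.
have stw : {in w, forall r, s r = t r}.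
  apply: (next_closed uw _ st0); first by rewrite wE.
  move=> r rw Er; apply/eqP; apply: contraT => nE.
  have [_ [E|E] _] := two _ nE.
    by case: (half s t r rw _ Er nE E) => i /st/andP[_ /in2].
  rewrite eq_sym in nE.
  by case: (half t s r rw _ (esym Er) nE E) => i; rewrite eq_sym => /st/andP[/in2].
apply/permP=> r; have [->//|rj] := eqVneq r j.
by apply: stw; rewrite wE.
Qed.

End HamiltonCycle.

(** * Completeness from linear orders and forbidden cycles *)

Section EdgeOfCycles.
Variable I : finType.
Variable D : {set I * I}.

(** The block from [i] to [j] is rotated by one place: each row takes the next column upwards, and
    [j] wraps around to [i]. *)
Lemma block_shift (L : rel I) (s1 s2 s3 : seq I) i j : reflexive L ->
  uniq (s1 ++ i :: s2 ++ j :: s3) -> path L i (rcons s2 j) ->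
  exists c : {perm I}, [/\ c j = i, forall r, r != j -> L r (c r),
    path (frel c) i (rcons s2 j) & {in s1 ++ s3, forall r, c r = r}].
Proof.
move=> Lr us iL; pose p := i :: rcons s2 j.
have Ep : s1 ++ i :: s2 ++ j :: s3 = s1 ++ p ++ s3 by rewrite /p /= cat_rcons.
move: us; rewrite Ep !cat_uniq has_cat => /and3P[_ /norP[/hasPn ps1 _] /and3P[up /hasPn ps3 _]].
have cinj : injective (next p) by apply: can_inj (prev_next up).
have pc : path (frel (next p)) i (rcons s2 j) && (next p j == i).
  by have := cycle_next up; rewrite /= rcons_path last_rcons.
have out r : r \notin p -> next p r = r.
  by move=> rp; rewrite next_nth (negbTE rp).
exists (perm cinj); split.
- by rewrite permE; case/andP: pc => _ /eqP.
- move=> r rj; rewrite permE; have [rp|/out->//] := boolP (r \in p).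
  have : path.cycle (fun u v => (u == j) || L u v) p.
    rewrite /= rcons_path last_rcons eqxx andbT.
    by apply: sub_path iL => u v ->; rewrite orbT.
  by move/next_cycle => /(_ _ rp); rewrite (negbTE rj).
- case/andP: pc => pc _; apply: sub_path pc => u v /=; by rewrite permE.
- move=> r; rewrite mem_cat permE => rs; apply: out.
  case/orP: rs => [|/ps3//]; by apply: contraL => /ps1.
Qed.

Hypothesis D_order : forall t, dmatching D setT t ->
  exists L : rel I, [/\ reflexive L, total L, transitive L &
                        forall i k, L i k -> (i, t k) \in D].
Hypothesis D_cycle : forall j (c : {perm I}) (w : seq I),
  uniq w -> w =i predC1 j -> (j, c j) \notin D ->
  (forall r, r != j -> (r, c r) \in D) ->
  path.cycle (fun r r' => (r, c r') \in D) w -> False.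
Hypothesis D_refl : forall i, (i, i) \in D.

(** The rows are sorted by the linear order attached to the identity. A missing entry [(j, i)] is
    made the missed pair of a row cycle: first for the last row [z], then, once row [z] is known to
    be full, for any other row. *)
Lemma edge_of_cycles i j : (j, i) \in D.
Proof.
have D1 : dmatching D setT 1 by apply: dmatching1.
have [L [Lr Lt Ltr LD1]] := D_order D1.
have {LD1} LD i' k : L i' k -> (i', k) \in D by move=> /LD1; rewrite perm1.
pose s := sort L (enum I).
have us : uniq s by rewrite sort_uniq enum_uniq.
have sI k : k \in s by rewrite mem_sort mem_enum.
have sL : sorted L s by apply: sort_sorted.
have split_s i' j' : (j', i') \notin D ->
    exists s1 s2 s3, s = s1 ++ i' :: s2 ++ j' :: s3.
  move=> nD; case/splitPr E: _ / (sI i') => [p1 p2].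
  have := sI j'; rewrite E mem_cat inE => /or3P[jp1|/eqP Eij|jp2].
  - have := sL; rewrite (sorted_pairwise Ltr) E pairwise_cat => /and3P[/allrelP al _ _].
    by case/negP: nD; apply/LD/al; rewrite ?inE ?eqxx.
  - by rewrite Eij D_refl in nD.
  - by case/splitPr E2: _ / jp2 => [s2 s3]; exists p1, s2, s3; rewrite -E2.
have top z s' y : s = rcons s' z -> L y z.
  move=> Es; have := sI y; rewrite Es mem_rcons inE => /predU1P[->//|ys].
  have := sL; rewrite (sorted_pairwise Ltr) Es -cats1 pairwise_cat.
  by case/andP=> /allrelP al _; apply: al; rewrite ?inE ?eqxx.
(* The cycle runs up through [s1], jumps to the end of the block [i' :: s2], and descends it using
   loops, since [c] sends each row of the block to its successor. It closes through [(i', o)] or,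
   when [s1] is empty, through the column [z], which every row reaches. *)
have last_row i' z s1 s2 : s = s1 ++ i' :: s2 ++ [:: z] ->
    (if s1 is o :: _ then (i', o) \in D else true) -> (z, i') \in D.
  move=> Es Do; apply: contraT => nD.
  have zL : path L i' (rcons s2 z).
    by have := sL; rewrite Es => /cat_sorted2[_]; rewrite -cats1.
  have us' : uniq (s1 ++ i' :: s2 ++ z :: [::]) by rewrite -Es.
  have [c [cz cL cp cs]] := block_shift Lr us' zL.
  have s1c r : r \in s1 -> c r = r by move=> rs; apply: cs; rewrite cats0.
  have mem_q : (i' :: s2) ++ rev s1 =i predC1 z.
    move=> y; rewrite mem_cat mem_rev orbC -mem_cat inE /=.
    have := sI y; rewrite Es -cat_cons catA cats1 mem_rcons inE.
    have : z \notin s1 ++ i' :: s2.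
      by move: us'; rewrite -cat_cons catA cats1 rcons_uniq => /andP[].
    by case: eqP => [-> /negbTE->|_ _ /= ->].
  case: (@D_cycle z c (rev ((i' :: s2) ++ rev s1))).
  - rewrite rev_uniq; have := us'; rewrite -cat_cons catA cats1 rcons_uniq => /andP[_ us1].
    by rewrite cat_uniq rev_uniq (eq_has_r (mem_rev s1)) -cat_uniq uniq_catC.
  - by move=> y; rewrite mem_rev mem_q.
  - by rewrite cz.
  - by move=> r rz; apply/LD/cL.
  rewrite rev_cycle /= rcons_cat cat_path.
  move: cp; rewrite [path _ _ (rcons s2 z)]rcons_path => /andP[cp /eqP cl].
  apply/andP; split; first by apply: sub_path cp => u v /= /eqP->.
  have : sorted (fun r r' => (r', c r) \in D) (rcons (rev s1) i').
    have sL1 : sorted L s1 by have := sL; rewrite Es => /cat_sorted2[].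
    rewrite -rev_cons rev_sorted; case: s1 Do sL1 s1c {Es us' mem_q cs} => //= o q Do oq s1c.
    rewrite s1c ?inE ?eqxx // Do /=.
    apply: (@sub_in_path _ (mem (o :: q)) L) oq; last exact/allP.
    by move=> u v _ vq uv /=; rewrite s1c ?LD.
  have : forall r, (r, c (last i' s2)) \in D.
    move=> r; rewrite cl; apply/LD/(top z (s1 ++ i' :: s2)).
    by rewrite Es -cat_cons catA cats1.
  by case: (rcons _ _) => //= u q lz ->; rewrite lz.
have last_full z s' y : s = rcons s' z -> (z, y) \in D.
  move=> Ez; apply: contraT => nD; have [s1 [s2 [s3 Es]]] := split_s _ _ nD.
  have s30 : s3 = [::].
    case/lastP: s3 Es => // s3 u Es; have := us; rewrite Es.
    have <- : z = u.
      by move: (congr1 (last z) Es); rewrite Ez last_rcons last_cat /= last_cat /= last_rcons.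
    by rewrite -cat_cons catA cat_uniq /= mem_rcons inE eqxx !andbF.
  rewrite s30 in Es; case: s1 Es => [|o s1] Es; first by rewrite (last_row _ _ _ _ Es) in nD.
  have zo : (z, o) \in D by apply: (last_row o z [::] (s1 ++ y :: s2)) => //; rewrite Es -catA.
  have oz : (o, z) \in D by apply/LD/top/Ez.
  have yo : y != o.
    by apply: contraTneq us => E; rewrite Es E /= mem_cat inE eqxx orbT.
  have yz : y != z by apply: contraNneq nD => ->.
  have Dt : dmatching D setT (tperm o z).
    apply/andP; split; first by apply/subsetP=> u; rewrite !inE.
    by apply/forall_inP=> u _; case: tpermP => [->|->|].
  (* In the order of the matching that swaps [o] and [z], comparing [y] with [z] gives [(y, o)] or
     [(z, y)]. The latter is the missing entry, and the former supplies the premise of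
     [last_row]. *)
  have [L' [_ Lt' _ LD']] := D_order Dt.
  have := Lt' y z; case/orP => /LD'; rewrite ?tpermR ?tpermD 1?eq_sym //; last by rewrite (negbTE nD).
  by move=> yoD; rewrite (last_row _ _ _ _ Es) in nD.
apply: contraT => nD; have [s1 [s2 [s3 Es]]] := split_s _ _ nD.
case/lastP: s3 Es => [|s3 z] Es.
  by rewrite (last_full j (s1 ++ i :: s2)) ?Es -?cat_cons ?catA ?cats1 in nD.
have jL : path L i (rcons s2 j).
  have := sL; rewrite Es => /cat_sorted2[_].
  by rewrite -cat_cons -cat_rcons => /cat_sorted2[].
have us' := us; rewrite Es in us'.
have [c [cj cL cp cs]] := block_shift Lr us' jL.
(* The rows other than [j] are visited in increasing order. Ascending steps stay in [D] because [c]
   only moves upwards away from [j], and the fullness of row [z] closes the cycle. *)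
have wE : s1 ++ i :: s2 ++ rcons s3 z =i predC1 j.
  move=> y; rewrite -cat_cons catA.
  by apply: mem_remove; [move: us' | move=> u; have := sI u; rewrite Es]; rewrite -cat_cons catA.
have wu : subseq (s1 ++ i :: s2 ++ rcons s3 z) s.
  by rewrite Es subseq_cat2l /= eqxx subseq_cat2l subseq_cons.
case: (@D_cycle j c (s1 ++ i :: s2 ++ rcons s3 z)) => //.
- exact: subseq_uniq wu us.
- by rewrite cj.
- by move=> r rj; apply/LD/cL.
have {wu} := subseq_sorted Ltr wu sL.
have : forall r, (z, c r) \in D.
  by move=> r; apply: (last_full z (s1 ++ i :: s2 ++ j :: s3)); rewrite Es rcons_cat /= rcons_cat.
have lw x : last x (s1 ++ i :: s2 ++ rcons s3 z) = z.
  by rewrite last_cat /= last_cat last_rcons.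
case: (s1 ++ i :: s2 ++ rcons s3 z) lw wE => //= x q lw wE zD xq.
rewrite rcons_path (lw x) zD andbT.
apply: (@sub_in_path _ (mem (x :: q)) L) xq; last exact/allP.
move=> u v _ vq uv /=; apply/LD/(Ltr _ _ _ uv)/cL.
by have : v \in predC1 j by rewrite -wE.
Qed.
End EdgeOfCycles.

(** * Translation between bipartite graphs and digraphs *)

Section Frame.
Variables (T I : finType).
Implicit Types (e : rel T) (a b : I -> T) (s t : {perm I}).

(** A frame numbers the two colour classes so that a chosen perfect matching becomes the diagonal;
    that matching is [bi_matching a b 1]. *)
Record frame e a b : Prop := Frame {
  frame_sym : symmetric e;
  frame_inj1 : injective a;
  frame_inj2 : injective b;
  frame_disj : forall i j, a i != b j;
  frame_cover : forall x, (exists i, x = a i) \/ (exists i, x = b i);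
  frame_indep1 : forall i j, ~~ e (a i) (a j);
  frame_indep2 : forall i j, ~~ e (b i) (b j);
  frame_diag : forall i, e (a i) (b i) }.

Definition biadj e a b : {set I * I} := [set p | e (a p.1) (b p.2)].
Definition bi_edge a b (p : I * I) : {set T} := [set a p.1; b p.2].
Definition bi_matching a b s : {set {set T}} := [set bi_edge a b (i, s i) | i : I].

Section Fixed.
Variables (e : rel T) (a b : I -> T).
Hypothesis fr : frame e a b.
Let D := biadj e a b.
Let em := bi_edge a b.
Let mm := bi_matching a b.

Lemma mem_row i p : (a i \in em p) = (i == p.1).
Proof.
by rewrite !inE (negbTE (frame_disj fr _ _)) orbF (inj_eq (frame_inj1 fr)).
Qed.

Lemma mem_col i p : (b i \in em p) = (i == p.2).
Proof.
by rewrite !inE eq_sym (negbTE (frame_disj fr _ _)) (inj_eq (frame_inj2 fr)).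
Qed.

Lemma bi_edge_inj : injective em.
Proof.
move=> [i j] [k l] E; have := mem_row i (k, l); have := mem_col j (k, l).
by rewrite -E mem_row mem_col !eqxx => /esym/eqP-> /esym/eqP->.
Qed.

Lemma bi_edgeP f : reflect (exists2 p, p \in D & f = em p) (f \in edges e).
Proof.
rewrite inE; apply: (iffP existsP) => [[x /existsP[y /andP[exy /eqP->]]]|[[i j] ij ->]].
  case: (frame_cover fr x) exy => -[i ->]; case: (frame_cover fr y) => -[j ->] exy.
  - by case/negP: (frame_indep1 fr i j).
  - by exists (i, j); rewrite ?inE.
  - by exists (j, i); [rewrite inE /= (frame_sym fr) | rewrite /em /bi_edge setUC].
  - by case/negP: (frame_indep2 fr i j).
by exists (a i); apply/existsP; exists (b j); move: ij; rewrite inE /= => ->; rewrite eqxx.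
Qed.

Lemma edges_biadj : edges e = em @: D.
Proof. by apply/setP=> f; apply/bi_edgeP/imsetP. Qed.

Lemma card_edges : #|edges e| = #|D|.
Proof. by rewrite edges_biadj (card_imset _ bi_edge_inj). Qed.

Lemma bi_preimset_sub (F : {set {set T}}) : F \subset edges e -> em @^-1: F \subset D.
Proof.
move=> Fe; apply/subsetP=> p; rewrite inE => /(subsetP Fe).
by case/bi_edgeP=> q qD /bi_edge_inj->.
Qed.

Lemma card_bi_preimset (F : {set {set T}}) : F \subset edges e -> #|em @^-1: F| = #|F|.
Proof.
move=> Fe; rewrite -(card_imset _ bi_edge_inj); apply: eq_card => f.
apply/imsetP/idP=> [[p + ->]|fF]; first by rewrite inE.
have /bi_edgeP[p _ Ef] := subsetP Fe f fF.
by exists p; rewrite // inE -Ef.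
Qed.

Lemma mem_bi_matching s i j : (em (i, j) \in mm s) = (j == s i).
Proof.
apply/imsetP/eqP=> [[k _ /bi_edge_inj[-> ->]] //|->].
by exists i.
Qed.

Lemma bi_matchingP M :
  reflect (exists2 s, dmatching D setT s & M = mm s) (perfect_matching e M).
Proof.
apply: (iffP idP) => [pM|[s /andP[_ /forall_inP sD] ->]]; last first.
  apply/andP; split.
    by apply/subsetP=> _ /imsetP[i _ ->]; rewrite edges_biadj imset_f ?sD ?inE.
  apply/forallP=> x; apply/cards1P; case: (frame_cover fr x) => -[i ->].
    exists (em (i, s i)); apply/setP=> f; rewrite !inE.
    apply/andP/eqP=> [[/imsetP[k _ ->]]|->]; first by rewrite mem_row => /eqP->.
    by rewrite mem_bi_matching mem_row !eqxx.
  pose k := (s^-1)%g i; have sk : s k = i by rewrite permKV.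
  exists (em (k, s k)); apply/setP=> f; rewrite !inE.
  apply/andP/eqP=> [[/imsetP[l _ ->]]|->].
    by rewrite mem_col /= -sk (inj_eq perm_inj) => /eqP->.
  by rewrite mem_bi_matching mem_col sk !eqxx.
have sub := subsetP (proj1 (andP pM)).
(* The default is never taken, since [M] covers [a i]. *)
pose s0 i := odflt i [pick j | em (i, j) \in M].
have s0M i : em (i, s0 i) \in M.
  rewrite /s0; case: pickP => //= none.
  have [f fM] := perfect_matching_cover (a i) pM.
  have /bi_edgeP[[k j] _ Ef] := sub f fM; rewrite Ef mem_row => /eqP /= Ek.
  by have := none j; rewrite Ek -Ef fM.
have s0inj : injective s0.
  move=> i k E; have Ei := s0M i; have := s0M k; rewrite -E => Ek.
  have : em (i, s0 i) = em (k, s0 i).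
    by apply: (perfect_matching_uniq pM Ei Ek (x := b (s0 i))); rewrite mem_col.
  by move/bi_edge_inj=> [].
have sM i : em (i, perm s0inj i) \in M by rewrite permE.
exists (perm s0inj).
  apply/andP; split; first by apply/subsetP=> i; rewrite inE.
  apply/forall_inP=> i _; have /bi_edgeP[p pD /bi_edge_inj->//] := sub _ (sM i).
apply/setP=> f; apply/idP/imsetP=> [fM|[i _ ->]]; last exact: sM.
have /bi_edgeP[[i j] _ Ef] := sub f fM; exists i => //.
by apply: (perfect_matching_uniq pM fM (sM i) (x := a i)); rewrite ?Ef mem_row.
Qed.

Lemma bi_matching_inj : injective mm.
Proof.
move=> s t E; apply/permP=> i; apply/eqP; rewrite -mem_bi_matching -E.
by rewrite mem_bi_matching.
Qed.

(** An edge [(i, s i)] lies in only one of the two matchings exactly when they differ at row [i]. *)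
Lemma nonconformalP (F : {set {set T}}) :
  nonconformal e F <-> discerning D setT (em @^-1: F).
Proof.
split=> [nF s t sD tD st|dF M1 M2 /bi_matchingP[s sD ->] /bi_matchingP[t tD ->] sub].
  apply: bi_matching_inj; apply: nF.
  - by apply/bi_matchingP; exists s.
  - by apply/bi_matchingP; exists t.
  apply/subsetP=> f; rewrite !inE => /orP[]/andP[nf /imsetP[i _ Ef]].
    move: nf; rewrite Ef mem_bi_matching => /st; rewrite !inE; by case/andP.
  by move: nf; rewrite Ef mem_bi_matching eq_sym => /st; rewrite !inE; case/andP.
congr (mm _); apply: dF => // i nst; rewrite !inE.
apply/andP; split; apply: (subsetP sub); rewrite !inE !mem_bi_matching eqxx.
  by rewrite (negbTE nst).
by rewrite eq_sym (negbTE nst) orbT.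
Qed.

Lemma unique_perfect_matchingP :
  reflect (forall s, dmatching D setT s -> s = 1%g) (unique_perfect_matching e).
Proof.
have D1 : dmatching D setT 1.
  by apply: dmatching1 => i _; rewrite inE (frame_diag fr).
apply: (iffP cards1P) => [[M EM] s sD|all1].
  have in_M t : dmatching D setT t -> mm t = M.
    by move=> tD; apply/set1P; rewrite -EM inE; apply/bi_matchingP; exists t.
  by apply: bi_matching_inj; rewrite !in_M.
exists (mm 1%g); apply/setP=> M; rewrite !inE.
apply/bi_matchingP/eqP=> [[s /all1-> //]|->]; by exists 1%g.
Qed.

End Fixed.

(** Renumbering the second class by [t] puts the matching [t] on the diagonal, so results about the
    diagonal matching reach every perfect matching. *)
Lemma frame_perm e a b t : frame e a b -> dmatching (biadj e a b) setT t ->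
  frame e a (b \o t).
Proof.
case=> sy i1 i2 dj cv d1 d2 dg /andP[_ /forall_inP tD]; split=> //=.
- exact: inj_comp i2 (@perm_inj _ t).
- move=> x; case: (cv x) => -[i ->]; [left; exists i | right] => //.
  by exists ((t^-1)%g i) => /=; rewrite permKV.
- by move=> i; have := tD i; rewrite !inE; apply.
Qed.

Lemma frame_del e a b (S : {set {set T}}) : frame e a b ->
  (forall i, bi_edge a b (i, i) \notin S) -> frame (del_edges e S) a b.
Proof.
case=> sy i1 i2 dj cv d1 d2 dg nS; split; rewrite /del_edges //=.
- by move=> x y /=; rewrite sy setUC.
- by move=> i j; rewrite (negbTE (d1 i j)).
- by move=> i j; rewrite (negbTE (d2 i j)).
- by move=> i; rewrite dg (nS i).
Qed.

Section Numbers.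
Variables (e : rel T) (a b : I -> T).
Hypothesis fr : frame e a b.
Let D := biadj e a b.
Let em := bi_edge a b.
Let M0 := bi_matching a b 1.

Lemma bi_matching1_pm : perfect_matching e M0.
Proof.
apply/(bi_matchingP fr); exists 1%g => //.
by apply: dmatching1 => i _; rewrite inE (frame_diag fr).
Qed.

Let biadj_del S : biadj (del_edges e S) a b = D :\: em @^-1: S.
Proof. by apply/setP=> p; rewrite !inE andbC. Qed.

Lemma af_leP (K : {set I * I}) : K \subset D -> (forall i, (i, i) \notin K) ->
  (forall s, dmatching D setT s -> (forall i, (i, s i) \notin K) -> s = 1%g) ->
  af e M0 <= #|K|.
Proof.
move=> KD Kd Ku; rewrite /af -(card_imset _ (bi_edge_inj fr)).
case: arg_minnP => [|S _]; first exact/anti_forcing_default/bi_matching1_pm.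
apply; rewrite /anti_forcing; apply/andP; split.
  apply/subsetP=> _ /imsetP[[i j] ij ->]; rewrite in_setD (mem_bi_matching fr) perm1.
  rewrite (edges_biadj fr) imset_f ?(subsetP KD) // andbT.
  by apply: contraNneq (Kd i) => E; rewrite -{2}E.
have fd : frame (del_edges e (bi_edge a b @: K)) a b.
  apply: frame_del => // i; apply/imsetP=> -[p pK /(bi_edge_inj fr) Ep].
  by have := Kd i; rewrite Ep pK.
apply/(unique_perfect_matchingP fd) => s; rewrite biadj_del => /andP[sT /forall_inP sD].
apply: Ku => [|i].
  by apply/andP; split=> //; apply/forall_inP=> i /sD; rewrite in_setD => /andP[].
have := sD i (in_setT i); rewrite in_setD inE => /andP[+ _].
by apply: contra => iK; apply: imset_f.
Qed.

Lemma af_attained : exists K : {set I * I},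
  [/\ K \subset D, forall i, (i, i) \notin K, #|K| = af e M0 &
      forall s, (forall i, (i, s i) \in D :\: K) -> s = 1%g].
Proof.
rewrite /af; case: arg_minnP => [|S /andP[SD Su] _]; first exact/anti_forcing_default/bi_matching1_pm.
have diag i : em (i, i) \notin S.
  apply/negP=> /(subsetP SD); rewrite in_setD (mem_bi_matching fr) perm1.
  by rewrite eqxx.
have Se := subset_trans SD (subsetDl _ _).
exists (em @^-1: S); split; last 1 first.
- move=> s sK; have fd := frame_del fr diag.
  apply: (unique_perfect_matchingP fd Su); rewrite biadj_del.
  by apply/andP; split; [apply/subsetP=> i; rewrite inE | apply/forall_inP].
- exact: (bi_preimset_sub fr Se).
- by move=> i; rewrite inE.
- exact: (card_bi_preimset fr Se).
Qed.

End Numbers.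
End Frame.

(** * Inequalities between [gf], [af] and the number of edges *)

Section Bounds.
Variables (T I : finType) (e : rel T) (a b : I -> T).
Hypothesis fr : frame e a b.
Let D := biadj e a b.
Let em := bi_edge a b.

Lemma biadj_refl i : (i, i) \in D.
Proof. by rewrite inE (frame_diag fr). Qed.

Lemma af_le_gf : af e (bi_matching a b 1) <= gf e.
Proof.
have [F [Fe nF cF]] := gf_attained e.
pose S := D :\: em @^-1: F.
have Dr : {in setT, forall i, (i, i) \in D} by move=> i _; exact: biadj_refl.
have dS : discerning D setT (D :\: S).
  move=> s t sD tD st; apply: (proj1 (nonconformalP fr F) nF s t sD tD) => i /st.
  by rewrite setDDr setDv set0U !in_setI => /andP[/andP[_ ->] /andP[_ ->]].
have [K [KD Kd cK Ku]] := anti_forcing_of_discerning Dr dS.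
have : af e (bi_matching a b 1) <= #|K|.
  by apply: (af_leP fr) => // s sD sK; apply: Ku => // i _; exact: sK.
suff <- : #|S| = gf e.
  by move/leq_trans; apply; apply: leq_trans cK _; apply/subset_leq_card/subsetIl.
rewrite /S cardsD (setIidPr (bi_preimset_sub fr Fe)) (card_bi_preimset fr Fe).
by have := card_edges fr; rewrite -/D; move: cF; lia.
Qed.

Lemma edges_le_af : 2 * #|edges e| <= 2 * af e (bi_matching a b 1) + #|I| * #|I|.+1.
Proof.
have [K [KD Kd cK Ku]] := af_attained fr.
have Lr i : (i, i) \in D :\: K by rewrite in_setD Kd biadj_refl.
have := unique_card Lr Ku; rewrite cardsD (setIidPr KD) (card_edges fr) -/D cK.
by have := subset_leq_card KD; rewrite cK; lia.
Qed.

Lemma edges_eq_af_order :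
  2 * #|edges e| = 2 * af e (bi_matching a b 1) + #|I| * #|I|.+1 ->
  exists L : rel I, [/\ reflexive L, total L, transitive L &
                        forall i k, L i k -> (i, k) \in D].
Proof.
have [K [KD Kd cK Ku]] := af_attained fr.
have Lr i : (i, i) \in D :\: K by rewrite in_setD Kd biadj_refl.
move=> E; have cL : 2 * #|D :\: K| = #|I| * #|I|.+1.
  have := subset_leq_card KD; rewrite cardsD (setIidPr KD).
  by move: E; rewrite (card_edges fr) -/D cK; lia.
exists (fun i k => (i, k) \in D :\: K); split.
- exact: Lr.
- exact: unique_max_total Lr Ku cL.
- by move=> j i k; apply: unique_max_trans Lr Ku cL _ _ _.
- by move=> i k; rewrite in_setD => /andP[].
Qed.

(** The complement of a minimum global forcing set is discerning in the complete digraph, hence has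
    at most [2 * #|I| - 1] elements. *)
Lemma gf_complete : 0 < #|I| -> D = setT -> #|I| ^ 2 < gf e + 2 * #|I|.
Proof.
move=> I0 DT; have [F [Fe nF cF]] := gf_attained e.
have := proj1 (nonconformalP fr F) nF; rewrite -/D DT => dF.
have I0' : [set: I] != set0 by rewrite -card_gt0 cardsT.
have FX : em @^-1: F \subset setX [set: I] [set: I].
  by apply/subsetP=> p; rewrite !inE.
have := discerning_complete_card I0' FX dF; rewrite cardsT.
rewrite (card_bi_preimset fr Fe).
by move: cF; rewrite (card_edges fr) -/D DT cardsT card_prod mulnn; lia.
Qed.

(** The cycle has as many edges as vertices, so extending it saves one edge more than a spanning
    tree does; compare [gf_spanning]. *)
Lemma gf_row_cycle j (c : {perm I}) (w : seq I) : connected e -> 2 < #|I| ->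
  uniq w -> w =i predC1 j -> (j, c j) \notin D ->
  (forall r, r != j -> (r, c r) \in D) ->
  path.cycle (fun r r' => (r, c r') \in D) w -> gf e + 2 * #|I| <= #|edges e|.
Proof.
move=> conn I3 uw wE jD cD wD.
pose F0 := em @: row_cycle j c w.
have sw : size w = #|I|.-1 by rewrite -(cardC1 j) -(eq_card wE); apply/esym/card_uniqP.
have cF0 : #|F0| = 2 * #|I|.-1.
  rewrite (card_imset _ (bi_edge_inj fr)) row_cycle_card //.
  by rewrite sw; lia.
have F0e : F0 \subset edges e.
  rewrite (edges_biadj fr); apply/imsetS/subsetP=> -[r y].
  rewrite inE /= => /andP[rj /orP[]/eqP->]; first exact: cD.
  by apply: (next_cycle wD); rewrite wE.
have nF0 : nonconformal e F0.
  apply/(nonconformalP fr) => s t sD tD st.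
  apply: (row_cycle_discerning uw wE jD sD tD) => i /st.
  by rewrite !inE !(mem_imset _ _ (bi_edge_inj fr)) !inE.
pose W := ~: [set a j; b (c j)].
have c2 : #|[set a j; b (c j)]| = 2 by rewrite cards2 (frame_disj fr).
have cW : (#|W|).+2 = #|T| by rewrite -(cardsC [set a j; b (c j)]) c2 add2n.
have FW : {in F0, forall f : {set T}, f \subset W}.
  move=> f /imsetP[p /(row_cycle_miss wE)/andP[p1 p2] ->].
  rewrite subUset !sub1set !inE (inj_eq (frame_inj1 fr)) (inj_eq (frame_inj2 fr)).
  by rewrite (negbTE p1) (negbTE p2) (negbTE (frame_disj fr _ _)) eq_sym (negbTE (frame_disj fr _ _)).
have W0 : W != set0.
  have : 0 < #|predC1 j| by rewrite cardC1; lia.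
  case/card_gt0P=> r rj; apply/set0Pn; exists (a r).
  by rewrite !inE (inj_eq (frame_inj1 fr)) (negbTE (frame_disj fr _ _)) orbF.
have [F [Fe nF cF]] := nonconformal_extend conn W0 F0e FW nF0.
by have := gf_leP Fe nF; move: cF; rewrite cF0; lia.
Qed.

Lemma gf_spanning : connected e -> 0 < #|T| -> gf e + #|T| <= #|edges e|.+1.
Proof.
move=> conn /card_gt0P[x _].
have [||||F [Fe nF cF]] := @nonconformal_extend _ e [set x] set0 conn.
- by apply/set0Pn; exists x; rewrite inE.
- exact: sub0set.
- by move=> f; rewrite inE.
- move=> M1 M2 _ _; rewrite subset0 setU_eq0 !setD_eq0 => /andP[M12 M21].
  by apply/eqP; rewrite eqEsubset M12.
by have := gf_leP Fe nF; move: cF; rewrite cards0 cards1; lia.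
Qed.

End Bounds.

(** * Complete bipartite graphs and the existence of frames *)

Lemma af_complete (T : finType) n (e : rel T) (a b : 'I_n -> T) :
  frame e a b -> biadj e a b = setT -> 2 * af e (bi_matching a b 1) <= n * n.-1.
Proof.
(* The pairs strictly above the diagonal are anti-forcing: avoiding them leaves [s i <= i] for all
   [i]. With their transposes they fill the off-diagonal, which gives their number. *)
move=> fr DT; pose K := [set p : 'I_n * 'I_n | p.1 < p.2].
have : af e (bi_matching a b 1) <= #|K|.
  apply: (af_leP fr) => [|i|s _ sK]; rewrite ?DT ?subsetT //; first by rewrite inE ltnn.
  by apply: perm_le_id => i; have := sK i; rewrite inE -leqNgt.
suff : 2 * #|K| = n * n.-1 by lia.
pose K' := [set (p.2, p.1) | p in K].
have cK' : #|K'| = #|K| by apply: card_imset => -[i j] [k l] [-> ->].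
have memK' i j : ((i, j) \in K') = (j < i).
  apply/imsetP/idP=> [[[k l]]|ji]; first by rewrite inE /= => kl [-> ->].
  by exists (j, i); rewrite ?inE.
have dK : [disjoint K & K'].
  rewrite -setI_eq0; apply/eqP/setP=> -[i j]; rewrite in_setI memK' !inE /=; lia.
have cU : #|K :|: K'| = 2 * #|K|.
  by rewrite cardsU (disjoint_setI0 dK) cards0 subn0 cK' mul2n addnn.
have EU : K :|: K' = ~: [set (i, i) | i : 'I_n].
  apply/setP=> -[i j]; rewrite in_setU memK' inE in_setC /=.
  rewrite -neq_ltn; congr (~~ _); apply/eqP/imsetP=> [/val_inj->|[k _ [-> ->]]] //.
  by exists j.
rewrite -cU EU cardsCs setCK card_prod card_imset; last by move=> i j [].
by rewrite card_ord; case: (n) => // m; rewrite /= mulnS addKn mulnC.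
Qed.

(** The partner map [p] of [M] is an involution exchanging the colour classes. So each class has [n]
    vertices, and an enumeration of [A] followed by [p] numbers the other class. *)
Lemma frame_exists (T : finType) (e : rel T) n (M : {set {set T}}) :
  symmetric e -> bipartite e -> #|T| = 2 * n -> perfect_matching e M ->
  exists a b : 'I_n -> T, frame e a b /\ bi_matching a b 1 = M.
Proof.
move=> sym [A eA] cT pM.
pose p x := odflt x [pick y | e x y && ([set x; y] \in M)].
have pP x : e x (p x) && ([set x; p x] \in M).
  rewrite /p; case: pickP => //= none.
  have [f fM xf] := perfect_matching_cover x pM.
  have := subsetP (proj1 (andP pM)) f fM.
  rewrite inE => /existsP[u /existsP[v /andP[uv /eqP Ef]]].
  move: xf fM; rewrite Ef !inE => /orP[]/eqP Ex fM.
    by have := none v; rewrite Ex uv fM.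
  by have := none u; rewrite Ex sym uv setUC fM.
have pe x : e x (p x) by case/andP: (pP x).
have pA x : (p x \in A) = (x \notin A).
  by have := eA _ _ (pe x); case: (x \in A); case: (p x \in A).
have pK : involutive p.
  move=> x; have /andP[_ xM] := pP x; have /andP[_ pxM] := pP (p x).
  have E : [set x; p x] = [set p x; p (p x)].
    by apply: (perfect_matching_uniq pM xM pxM (x := p x)); rewrite !inE eqxx ?orbT.
  have : p (p x) \in [set x; p x] by rewrite E !inE eqxx orbT.
  rewrite !inE => /orP[/eqP//|/eqP E'].
  by have := pA (p x); rewrite E'; case: (p x \in A).
have pinj := can_inj pK.
have cA : #|A| = n.
  have le1 : #|A| <= #|~: A|.
    rewrite -(card_imset _ pinj); apply/subset_leq_card/subsetP=> _ /imsetP[x xA ->].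
    by rewrite inE pA negbK.
  have le2 : #|~: A| <= #|A|.
    rewrite -(card_imset _ pinj); apply/subset_leq_card/subsetP=> _ /imsetP[x xA ->].
    by rewrite inE in xA; rewrite pA.
  by have := cardsC A; rewrite cT; lia.
pose a i := enum_val (cast_ord (esym cA) i).
have aA i : a i \in A by apply: enum_valP.
have fr : frame e a (p \o a).
  split=> //=.
  - by move=> i j /enum_val_inj/cast_ord_inj.
  - by move=> i j /pinj/enum_val_inj/cast_ord_inj.
  - by move=> i j; apply: contraTneq (aA i) => ->; rewrite pA aA.
  - have onA x : x \in A -> exists i, x = a i.
      move=> xA; exists (cast_ord cA (enum_rank_in xA x)).
      by rewrite /a cast_ordK enum_rankK_in.
    move=> x; have [/onA|xA] := boolP (x \in A); [by left | right].
    by have [|i Ei] := onA (p x); rewrite ?pA //; exists i; rewrite -Ei pK.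
  - by move=> i j; apply/negP=> /eA; rewrite !aA.
  - by move=> i j; apply/negP=> /eA; rewrite !pA !aA.
exists a, (p \o a); split=> //.
move: pM => /(bi_matchingP fr)[s _ EM]; rewrite EM; congr bi_matching.
apply/permP=> i; rewrite perm1; apply/eqP; rewrite -(mem_bi_matching fr) -EM.
by have /andP[] := pP (a i).
Qed.

Lemma complete_isomorphic (T : finType) (e : rel T) n (a b : 'I_n -> T) :
  frame e a b -> #|T| = 2 * n -> biadj e a b = setT ->
  isomorphic e (complete_bipartite n n).
Proof.
move=> fr cT DT; pose g (u : 'I_n + 'I_n) := match u with inl i => a i | inr i => b i end.
have ginj : injective g.
  move=> [i|i] [k|k] /= E.
  - by rewrite (frame_inj1 fr E).
  - by have := frame_disj fr i k; rewrite E eqxx.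
  - by have := frame_disj fr k i; rewrite E eqxx.
  - by rewrite (frame_inj2 fr E).
have ge u v : complete_bipartite n n u v = e (g u) (g v).
  have eab i k : e (a i) (b k) by have := in_setT (i, k); rewrite -DT inE.
  case: u v => [i|i] [k|k] /=; first by rewrite (negbTE (frame_indep1 fr _ _)).
  - by rewrite eab.
  - by rewrite (frame_sym fr) eab.
  - by rewrite (negbTE (frame_indep2 fr _ _)).
have [|f gK fK] := inj_card_bij ginj; first by rewrite cT card_sum card_ord mul2n addnn.
by exists f => [|x y]; [exists g | rewrite ge !fK].
Qed.

Lemma biadj_of_isomorphic (T : finType) (e : rel T) n (a b : 'I_n -> T) :
  frame e a b -> isomorphic e (complete_bipartite n n) -> biadj e a b = setT.
Proof.
move=> fr [f _ fe]; pose sd x := if f x is inl _ then true else false.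
have eE x y : e x y = (sd x != sd y).
  by rewrite -fe /sd; case: (f x) => ?; case: (f y).
apply/setP=> -[i j]; rewrite !inE /= eE.
(* [a i] and [a j] are not adjacent, so they lie on the same side, and [b j] lies opposite [a j]. *)
have := frame_diag fr j; have := frame_indep1 fr i j; rewrite !eE.
by case: (sd _) (sd _) (sd _) => -[] [].
Qed.

(** * The bounds and the equality case over the natural numbers *)

Section Main.
Variables (T : finType) (e : rel T) (n : nat).
Hypotheses (e_sym : symmetric e) (e_conn : connected e) (e_bip : bipartite e).
Hypotheses (e_pm : exists M : {set {set T}}, perfect_matching e M).
Hypotheses (card_T : #|T| = 2 * n) (n_ge : 2 < n).

Lemma Af_le_gf : Af e <= gf e.
Proof.
apply/bigmax_leqP => M pM.
by have [a [b [fr <-]]] := frame_exists e_sym e_bip card_T pM; exact: af_le_gf.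
Qed.

Let gf_le : gf e + 2 * n <= #|edges e|.+1.
Proof. by rewrite -card_T; apply: gf_spanning => //; rewrite card_T; lia. Qed.

Let edges_le M : perfect_matching e M ->
  2 * #|edges e| <= 2 * af e M + n * n.+1 /\ af e M <= Af e.
Proof.
move=> pM; split; last exact: (leq_bigmax_cond M pM).
have [a [b [fr <-]]] := frame_exists e_sym e_bip card_T pM.
by have := edges_le_af fr; rewrite card_ord.
Qed.

(** This is the upper bound doubled and freed of subtraction, using
    [(n - 1) * (n - 2) = n ^ 2 - 3 * n + 2]. *)
Lemma gf_le_Af : 2 * gf e + 3 * n <= 2 * Af e + n ^ 2 + 2.
Proof. by have [M /edges_le[]] := e_pm; move: gf_le; nia. Qed.

Lemma gf_eq_Af_isomorphic :
  2 * gf e + 3 * n = 2 * Af e + n ^ 2 + 2 <-> isomorphic e (complete_bipartite n n).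
Proof.
have [M0 pM0] := e_pm.
have [a [b [fr _]]] := frame_exists e_sym e_bip card_T pM0.
split=> [E|iso]; last first.
  have DT := biadj_of_isomorphic fr iso.
  have := gf_complete fr _ DT; rewrite card_ord => /(_ (ltnW (ltnW n_ge))).
  have : 2 * Af e <= n * n.-1.
    suff : Af e <= (n * n.-1) ./2 by lia.
    apply/bigmax_leqP=> M pM.
    have [a' [b' [fr' <-]]] := frame_exists e_sym e_bip card_T pM.
    by have := af_complete fr' (biadj_of_isomorphic fr' iso); lia.
  by have := gf_le_Af; nia.
apply: (complete_isomorphic fr card_T); apply/setP=> -[j i].
(* Equality makes the spanning tree bound tight and the bound of [edges_le] tight for every
   matching. The latter yields a linear order for each [t]; the former excludes the extra edge that
   a row cycle would save. *)
rewrite [RHS]inE; apply: edge_of_cycles => [t tD|k c w uw wE kD cD wD|k].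
- have fr' := frame_perm fr tD.
  have [m1 m2] := edges_le (bi_matching1_pm fr').
  have [|L [Lr Lt Ltr LD]] := edges_eq_af_order fr'.
    by rewrite card_ord; move: gf_le; nia.
  by exists L; split=> // u v /LD; rewrite !inE.
- have := gf_row_cycle fr e_conn _ uw wE kD cD wD; rewrite card_ord => /(_ n_ge).
  by have [m1 m2] := edges_le pM0; nia.
- exact: biadj_refl.
Qed.

End Main.

Import Order.TTheory GRing.Theory Num.Theory.
Local Open Scope ring_scope.

Theorem theorem3p5 (T : finType) (e : rel T) (n : nat)
    (e_sym : symmetric e) (e_irr : irreflexive e)
    (e_conn : connected e) (e_bip : bipartite e)
    (e_pm : exists M : {set {set T}}, perfect_matching e M)
    (card_T : #|T| = (2 * n)%N) (n_ge : (6 <= 2 * n)%N) :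
  (0 <= (gf e)%:R - (Af e)%:R :> rat) /\
  ((gf e)%:R - (Af e)%:R <= 1 / 2 * (n%:R - 1) * (n%:R - 2) :> rat) /\
  ((gf e)%:R - (Af e)%:R = 1 / 2 * (n%:R - 1) * (n%:R - 2) :> rat <->
     isomorphic e (complete_bipartite n n)).
Proof.
have n3 : (2 < n)%N by lia.
split; first by rewrite subr_ge0 ler_nat (Af_le_gf e_sym e_bip card_T).
have le := gf_le_Af e_sym e_conn e_bip e_pm card_T n3.
split; first by move: le; rewrite -(ler_nat rat) !natrD natrX; lra.
rewrite -(gf_eq_Af_isomorphic e_sym e_conn e_bip e_pm card_T n3).
split=> [E|/(congr1 (fun k => k%:R : rat))]; last by rewrite !natrD natrX; lra.
by apply/eqP; rewrite -(eqr_nat rat) !natrD natrX; apply/eqP; lra.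
Qed.
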